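(* Let $M$ be a complete locally separable metric space with $\operatorname{dens} M\leq 2^{\omega}$. Then $(\operatorname{Lip}_0(M),w^* )$ is separable.
   Context: $M$ has a distinguished base point $0$. $\operatorname{Lip}_0(M)$ is the Banach space of real-valued Lipschitz functions $f$ on $M$ with $f(0)=0$, normed by the best Lipschitz constant. For $x\in M$, $\delta(x)\in \operatorname{Lip}_0(M)^*$ is evaluation at $x$; $\mathcal F(M)=\overline{\operatorname{span}}\{\delta(x):x\in M\}\subset \operatorname{Lip}_0(M)^*$ is the Lipschitz-free space, and $\mathcal F(M)^*=\operatorname{Lip}_0(M)$ isometrically. The $w^*$ topology on $\operatorname{Lip}_0(M)$ is the one induced by the predual $\mathcal F(M)$. $\operatorname{dens}$ is the smallest cardinality of a dense subset; $2^\omega$ is the cardinality of the continuum. Locally separable means that every point has a separable neighborhood. *)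

(* Defs.v *)
From HB Require Import structures.
From mathcomp Require Import all_boot all_order all_algebra.
From mathcomp Require Import all_classical all_reals all_analysis.

Set Implicit Arguments.
Unset Strict Implicit.
Unset Printing Implicit Defensive.

Import Order.TTheory GRing.Theory Num.Theory.
Import numFieldNormedType.Exports.

Local Open Scope classical_set_scope.
Local Open Scope ring_scope.

Definition separable (T : topologicalType) : Prop :=
  exists2 D : set T, countable D & dense D.

(* U is regarded as a space with the topology induced by T. *)
Definition locally_separable (T : topologicalType) : Prop :=
  forall x : T, exists2 U : set T, nbhs x U & separable (set_type U).

(* dens T <= #|A|: the minimum defining dens T is attained, cardinals being
   well ordered. *)
Definition dens_le (T : topologicalType) (X : Type) (A : set X) : Prop :=
  exists2 D : set T, dense D & (D #<= A)%card.

(* The distinguished base point 0 of M is [point : M]. *)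
#[short(type="pMetricType")]
HB.structure Definition PointedMetric (K : numDomainType) :=
  {M of Metric K M & isPointed M}.

#[short(type="completeMetricType")]
HB.structure Definition CompleteMetric (K : numDomainType) :=
  {M of Metric K M & Complete M}.

Section dual.
Context {R : realType} (V : normedModType R).

Definition dual_pred : {pred V -> R^o} :=
  [pred f : V -> R^o | `[< linear f /\ continuous f >]].

Definition dual := {f : V -> R^o | f \in dual_pred}.

HB.instance Definition _ := SubChoice.on dual.

Definition dual_fun (phi : dual) : V -> R^o := \val phi.
Coercion dual_fun : dual >-> Funclass.

Let dual_linear (phi : dual) : linear phi.
Proof. by have := valP phi; rewrite inE => -[]. Qed.

HB.instance Definition _ (phi : dual) :=
  GRing.isLinear.Build R V R^o *:%R (dual_fun phi) (dual_linear phi).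

Lemma dual_continuous (phi : dual) : continuous phi.
Proof. by have := valP phi; rewrite inE => -[]. Qed.

Let dual_submod_closed : submod_closed dual_pred.
Proof.
split=> [|a f g].
  rewrite inE; split=> [a u v|]; last exact: cst_continuous.
  by rewrite /= -![(0 : V -> R^o) _]/(0 : R^o) scaler0 addr0.
rewrite !inE => -[lf cf] [lg cg].
split=> [b u v|x].
  rewrite /= -![(a *: f + g) _]/(a *: f _ + g _) lf lg.
  by rewrite !scalerDr !scalerA (mulrC b a) addrACA.
by apply: cvgD; [apply: cvgZl_tmp; exact: cf|exact: cg].
Qed.

HB.instance Definition _ :=
  GRing.isSubmodClosed.Build R (V -> R^o) dual_pred dual_submod_closed.
HB.instance Definition _ := [SubChoice_isSubLmodule of dual by <:].

Definition dual_norm (phi : dual) : R :=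
  sup [set `|phi x| | x in [set x : V | `|x| <= 1]].

Let dual_has_sup (phi : dual) :
  has_sup [set `|phi x| | x in [set x : V | `|x| <= 1]].
Proof.
split; first by exists `|phi 0|; exists 0 => //=; rewrite normr0.
have /linear_boundedP/pinfty_ex_gt0[r r0 rphi] :=
  continuous_linear_bounded 0 (@dual_continuous phi 0).
exists r => _ [x /= x1 <-].
by rewrite (le_trans (rphi x))// ler_piMr// ltW.
Qed.

Lemma dual_norm_ge0 (phi : dual) : 0 <= dual_norm phi.
Proof.
apply: (@le_trans _ _ `|phi 0|) => //.
apply: sup_upper_bound; first exact: dual_has_sup.
by exists 0 => //=; rewrite normr0.
Qed.

Lemma dual_normP (phi : dual) x : `|phi x| <= dual_norm phi * `|x|.
Proof.
have [->|x0] := eqVneq x 0; first by rewrite linear0 !normr0 mulr0.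
rewrite -ler_pdivrMr ?normr_gt0//.
have -> : `|phi x| / `|x| = `|phi (`|x|^-1 *: x)|.
  by rewrite linearZ/= normrZ mulrC ger0_norm ?invr_ge0.
apply: sup_upper_bound; first exact: dual_has_sup.
by exists (`|x|^-1 *: x) => //=; rewrite normfZV.
Qed.

Lemma dual_norm_le (phi : dual) (C : R) :
  0 <= C -> (forall x, `|phi x| <= C * `|x|) -> dual_norm phi <= C.
Proof.
move=> C0 phiC; apply: ge_sup; first by case: (dual_has_sup phi).
by move=> _ [x /= x1 <-]; rewrite (le_trans (phiC x))// ler_piMr.
Qed.

Let dual_normD (phi psi : dual) :
  dual_norm (phi + psi) <= dual_norm phi + dual_norm psi.
Proof.
apply: dual_norm_le => [|x]; first by rewrite addr_ge0 ?dual_norm_ge0.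
rewrite -[dual_fun (phi + psi) x]/(phi x + psi x) (le_trans (ler_normD _ _))// mulrDl.
by rewrite lerD ?dual_normP.
Qed.

Let dual_normZ_le (a : R) (phi : dual) :
  dual_norm (a *: phi) <= `|a| * dual_norm phi.
Proof.
apply: dual_norm_le => [|x]; first by rewrite mulr_ge0 ?dual_norm_ge0.
by rewrite -[dual_fun (a *: phi) x]/(a * phi x) normrM -mulrA ler_wpM2l ?dual_normP.
Qed.

Let dual_normZ (a : R) (phi : dual) :
  dual_norm (a *: phi) = `|a| * dual_norm phi.
Proof.
apply/eqP; rewrite eq_le dual_normZ_le/=.
have [->|a0] := eqVneq a 0; first by rewrite normr0 mul0r dual_norm_ge0.
rewrite -ler_pdivlMl ?normr_gt0// -normfV.
by rewrite -{1}[phi](scalerK a0) dual_normZ_le.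
Qed.

Let dual_norm0_eq0 (phi : dual) : dual_norm phi = 0 -> phi = 0.
Proof.
move=> phi0; apply/val_inj/funext => x; apply/eqP; rewrite -normr_le0.
by have := dual_normP phi x; rewrite phi0 mul0r.
Qed.

HB.instance Definition _ := @Lmodule_isNormed.Build R dual
  dual_norm dual_normD dual_normZ dual_norm0_eq0.

End dual.

Section lip0.
Context {R : realType} (M : pMetricType R).

(* [0 <= L] only matters when M is a singleton. *)
Definition lip_consts (f : M -> R) : set R :=
  [set L | 0 <= L /\ forall x y, `|f x - f y| <= L * mdist x y].

Definition lip0_pred : {pred M -> R^o} :=
  [pred f : M -> R^o | `[< f point = 0 /\ lip_consts f !=set0 >]].

Definition lip0 := {f : M -> R^o | f \in lip0_pred}.

HB.instance Definition _ := SubChoice.on lip0.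

Definition lip0_fun (f : lip0) : M -> R^o := \val f.
Coercion lip0_fun : lip0 >-> Funclass.

Lemma lip0_point (f : lip0) : f point = 0.
Proof. by have := valP f; rewrite inE => -[]. Qed.

Let lip0_consts (f : lip0) : lip_consts f !=set0.
Proof. by have := valP f; rewrite inE => -[]. Qed.

Let lip0_submod_closed : submod_closed lip0_pred.
Proof.
split=> [|a f g].
  rewrite inE; split=> //; exists 0; split=> // x y.
  by rewrite subrr normr0 mul0r.
rewrite !inE => -[f0 [K [K0 fK]]] [g0 [L [L0 gL]]]; split.
  by rewrite -[(a *: f + g) _]/(a * f _ + g _) f0 g0 mulr0 addr0.
exists (`|a| * K + L); split=> [|x y]; first by rewrite addr_ge0 ?mulr_ge0.
rewrite -![(a *: f + g) _]/(a * f _ + g _) opprD addrACA -mulrBr.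
by rewrite (le_trans (ler_normD _ _))// mulrDl normrM -mulrA lerD ?ler_wpM2l.
Qed.

HB.instance Definition _ :=
  GRing.isSubmodClosed.Build R (M -> R^o) lip0_pred lip0_submod_closed.
HB.instance Definition _ := [SubChoice_isSubLmodule of lip0 by <:].

Definition lip0_norm (f : lip0) : R := inf (lip_consts f).

Let lip0_has_inf (f : lip0) : has_inf (lip_consts f).
Proof. by split=> //; exists 0 => L []. Qed.

Lemma lip0_norm_ge0 (f : lip0) : 0 <= lip0_norm f.
Proof. by apply: lb_le_inf => // L []. Qed.

Lemma lip0_normP (f : lip0) x y : `|f x - f y| <= lip0_norm f * mdist x y.
Proof.
have [->|xy] := eqVneq x y; first by rewrite subrr normr0 mdistxx mulr0.
rewrite -ler_pdivrMr ?mdist_gt0//; apply: lb_le_inf => // L [L0 fL].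
by rewrite ler_pdivrMr ?mdist_gt0.
Qed.

Lemma lip0_norm_le (f : lip0) (L : R) :
  0 <= L -> (forall x y, `|f x - f y| <= L * mdist x y) -> lip0_norm f <= L.
Proof. by move=> L0 fL; apply: ge_inf => //; case: (lip0_has_inf f). Qed.

Let lip0_normD (f g : lip0) : lip0_norm (f + g) <= lip0_norm f + lip0_norm g.
Proof.
apply: lip0_norm_le => [|x y]; first by rewrite addr_ge0 ?lip0_norm_ge0.
rewrite -![lip0_fun (f + g) _]/(f _ + g _) opprD addrACA (le_trans (ler_normD _ _))//.
by rewrite mulrDl lerD ?lip0_normP.
Qed.

Let lip0_normZ_le (a : R) (f : lip0) :
  lip0_norm (a *: f) <= `|a| * lip0_norm f.
Proof.
apply: lip0_norm_le => [|x y]; first by rewrite mulr_ge0 ?lip0_norm_ge0.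
rewrite -![lip0_fun (a *: f) _]/(a * f _) -mulrBr normrM -mulrA ler_wpM2l//.
exact: lip0_normP.
Qed.

Let lip0_normZ (a : R) (f : lip0) : lip0_norm (a *: f) = `|a| * lip0_norm f.
Proof.
apply/eqP; rewrite eq_le lip0_normZ_le/=.
have [->|a0] := eqVneq a 0; first by rewrite normr0 mul0r lip0_norm_ge0.
rewrite -ler_pdivlMl ?normr_gt0// -normfV.
by rewrite -{1}[f](scalerK a0) lip0_normZ_le.
Qed.

Let lip0_norm0_eq0 (f : lip0) : lip0_norm f = 0 -> f = 0.
Proof.
move=> f0; apply/val_inj/funext => x; apply/eqP; rewrite -normr_le0.
by have := lip0_normP f x point; rewrite f0 mul0r lip0_point subr0.
Qed.

HB.instance Definition _ := @Lmodule_isNormed.Build R lip0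
  lip0_norm lip0_normD lip0_normZ lip0_norm0_eq0.

Definition delta_fun (x : M) : lip0 -> R^o := fun f => f x.

Let delta_fun_linear (x : M) : linear (delta_fun x).
Proof. by []. Qed.

HB.instance Definition _ (x : M) :=
  GRing.isLinear.Build R lip0 R^o *:%R (delta_fun x) (@delta_fun_linear x).

Let delta_fun_dual (x : M) : delta_fun x \in @dual_pred R lip0.
Proof.
rewrite inE; split; first exact: delta_fun_linear.
apply: bounded_linear_continuous; apply/linear_boundedP.
near=> r => f; have := lip0_normP f x point; rewrite lip0_point subr0.
move=> /le_trans; apply; rewrite mulrC ler_wpM2r ?lip0_norm_ge0//.
Unshelve. all: by end_near. Qed.

Definition delta (x : M) : dual lip0 := exist _ (delta_fun x) (delta_fun_dual x).

Definition delta_span : set (dual lip0) :=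
  [set mu | exists n (c : 'I_n -> R) (x : 'I_n -> M),
              mu = \sum_(i < n) c i *: delta (x i)].

(* The closure is for the dual norm of Lip_0(M)^*. *)
Definition lip_free : set (dual lip0) := closure delta_span.

(* Lip_0(M) with the coarsest topology making f |-> mu f continuous for all
   mu in the predual F(M). *)
Definition lip0_wstar : Type :=
  initial_topology
    (fun f : lip0 => (fun mu : lip_free => \val mu f) : {ptws lip_free -> R^o}).

HB.instance Definition _ := Topological.on lip0_wstar.

End lip0.

Arguments delta_span {R} M.
Arguments lip_free {R} M.

(* Main.v *)
(* The predual F(M) acts on norm bounded sets of Lip_0(M) continuously for
   pointwise convergence, and a set of Lipschitz functions is w*-total as soon as
   no nonzero mu in F(M) vanishes on it; so a countable separating set suffices,
   its rational span being w*-dense.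

   Localization: if mu(g) <> 0 with g bounded, then mu is close to a functional
   with finite support F, hence mu(g * phi) <> 0 for phi the maximum of tents of
   radius r centred on F, and one of the finitely many increments of this maximum
   still detects mu.  Iterating with r = 1/n and using completeness, one obtains a
   point x such that mu is nonzero on bounded nonnegative Lipschitz functions
   supported in arbitrarily small balls around x.

   Separation: for fixed r = 1/n, the centres of separable r-balls split into
   classes by chains of steps shorter than r.  Classes are separable, mutually
   r-separated, and injectively coded by elements of 2^omega since
   dens M <= 2^omega.  A nonnegative Lipschitz function supported near x in one
   class is a supremum of countably many cones; copying a finite set of cones
   simultaneously in all the classes whose code extends a finite word gives
   countably many functions, uniformly Lipschitz for a given slope, and these
   approximate the given function on any finite set. *)

Require Import Defs.
From mathcomp Require Import all_boot all_order all_algebra.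
From mathcomp Require Import all_classical all_reals all_analysis.
From mathcomp Require Import lra ring.
From Stdlib Require Import Relation_Operators.

Set Implicit Arguments.
Unset Strict Implicit.
Unset Printing Implicit Defensive.

Import Order.TTheory GRing.Theory Num.Theory.
Import numFieldNormedType.Exports.

Local Open Scope classical_set_scope.
Local Open Scope ring_scope.

Lemma natSinv_lt {R : realType} (eps : R) : 0 < eps -> exists n, n.+1%:R^-1 < eps :> R.
Proof.
move=> e0; have [n _ /(_ n (leqnn n))] := near_infty_natSinv_lt (PosNum e0).
by exists n.
Qed.

(** * Lipschitz constants and passage to [lip0] *)

Section lipschitz.
Context {R : realType} {M : pMetricType R}.
Implicit Types (f g : M -> R) (K L : R).

Lemma lip_constsD f g K L : lip_consts f K -> lip_consts g L ->
  lip_consts (fun x => f x + g x) (K + L).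
Proof.
move=> [K0 fK] [L0 gL]; split=> [|x y]; first exact: addr_ge0.
rewrite opprD addrACA mulrDl (le_trans (ler_normD _ _))//.
by rewrite lerD ?fK ?gL.
Qed.

Lemma lip_constsN f K : lip_consts f K -> lip_consts (fun x => - f x) K.
Proof. by move=> [K0 fK]; split=> // x y; rewrite -opprD normrN. Qed.

Lemma lip_constsM f g K L b : lip_consts f K -> lip_consts g L ->
  (forall x, 0 <= f x <= b) -> (forall x, 0 <= g x <= 1) ->
  lip_consts (fun x => f x * g x) (K + b * L).
Proof.
move=> [K0 fK] [L0 gL] fb g1.
have b0 : 0 <= b by have /andP[/le_trans] := fb point; apply.
split=> [|x y]; first by rewrite addr_ge0 ?mulr_ge0.
have -> : f x * g x - f y * g y = (f x - f y) * g x + f y * (g x - g y) by ring.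
rewrite (le_trans (ler_normD _ _))// [leRHS]mulrDl !normrM lerD//.
  have /andP[g0x g1x] := g1 x.
  by rewrite (ger0_norm g0x) (le_trans _ (fK x y))// ler_piMr.
have /andP[f0 f1] := fb y.
by rewrite (ger0_norm f0) -mulrA ler_pM.
Qed.

Lemma lip_consts_max f g K : lip_consts f K -> lip_consts g K ->
  lip_consts (fun x => Num.max (f x) (g x)) K.
Proof.
move=> [K0 fK] [_ gK]; split=> // x y.
have := fK x y; have := gK x y; rewrite !ler_norml.
by case: (leP (f x) (g x)); case: (leP (f y) (g y)) => *; lra.
Qed.

Lemma lip_consts_cst (c : R) : lip_consts (fun _ : M => c) 0.
Proof. by split=> // x y; rewrite subrr normr0 mul0r. Qed.

Lemma lip_consts_le f K L : K <= L -> lip_consts f K -> lip_consts f L.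
Proof.
move=> KL [K0 fK]; split=> [|x y]; first exact: le_trans KL.
by rewrite (le_trans (fK x y))// ler_wpM2r// mdist_ge0.
Qed.

Lemma lip_consts_mdist (p : M) : lip_consts (fun x => - mdist p x) 1.
Proof.
split=> // x y; rewrite mul1r ler_norml.
have := metric_triangle p y x; have := metric_triangle p x y.
by rewrite (metric_sym y x) => *; apply/andP; split; lra.
Qed.

(** The family enters only through its sets of values: when [z] is the value at [x] of a
    [K]-Lipschitz member, its value at [y] serves as [w]. *)
Lemma lip_consts_sup (F : M -> set R) K (b : R) :
  0 <= K -> (forall x, F x !=set0) -> (forall x z, F x z -> z <= b) ->
  (forall x y z, F x z -> exists2 w, F y w & z <= w + K * mdist x y) ->
  lip_consts (fun x => sup (F x)) K.
Proof.
move=> K0 F0 Fb FK.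
have main x y : sup (F x) <= sup (F y) + K * mdist x y.
  apply: ge_sup => // z /FK-/(_ y)[w Fw /le_trans]; apply.
  rewrite lerD2r; apply: ub_le_sup => //.
  by exists b => ?; exact: Fb.
split=> // x y; rewrite ler_norml; apply/andP; split.
  by have := main y x; rewrite metric_sym; lra.
by have := main x y; lra.
Qed.

(** Lets functionals on [lip0] act on Lipschitz functions that do not vanish at the base point;
    [insubd] returns the default 0 when [f] is not Lipschitz. *)
Definition recenter f : lip0 M :=
  insubd (0 : lip0 M) ((fun x => f x - f point) : M -> R^o).

Lemma recenterE f K x : lip_consts f K -> recenter f x = f x - f point.
Proof.
move=> fK; rewrite /lip0_fun /recenter val_insubd inE ifT//.
apply/asboolP; split; first by rewrite subrr.
exists K; case: fK => K0 fK; split=> // y z.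
by rewrite opprB addrA subrK.
Qed.

Lemma norm_recenter_le f K : lip_consts f K -> `|recenter f| <= K.
Proof.
move=> fK; apply: lip0_norm_le => [|x y]; first by case: fK.
by rewrite !(recenterE _ fK) opprB addrA subrK; case: fK.
Qed.

Lemma lip0P (f g : lip0 M) : (forall x, f x = g x) -> f = g.
Proof. by move=> fg; apply/val_inj/funext. Qed.

Lemma recenter_id (f : lip0 M) : recenter f = f.
Proof.
apply: lip0P => x; rewrite (@recenterE _ `|f|) ?lip0_point ?subr0//.
by split=> [|y z]; [exact: normr_ge0|exact: lip0_normP].
Qed.

Lemma recenterD f g K L : lip_consts f K -> lip_consts g L ->
  recenter (fun x => f x + g x) = recenter f + recenter g.
Proof.
move=> fK gL; apply: lip0P => x.
rewrite -[lip0_fun (_ + _) x]/(recenter f x + recenter g x).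
by rewrite (recenterE _ (lip_constsD fK gL)) (recenterE _ fK) (recenterE _ gL); ring.
Qed.

Lemma recenter_cst (c : R) : recenter (fun _ : M => c) = 0.
Proof.
by apply: lip0P => x; rewrite (recenterE _ (lip_consts_cst c)) subrr.
Qed.

Lemma recenterN f K : lip_consts f K -> recenter (fun x => - f x) = - recenter f.
Proof.
move=> fK; apply/eqP; rewrite -addr_eq0 -(recenterD (lip_constsN fK) fK).
rewrite -[X in _ == X](recenter_cst 0); apply/eqP; congr recenter.
by apply/funext => x; rewrite addNr.
Qed.

End lipschitz.

(** * Tight functionals and localization *)

Section tight.
Context {R : realType} {M : pMetricType R}.
Implicit Types (mu nu : dual (lip0 M)) (g : M -> R) (b K r : R).

(* The only consequence of membership in the predual that is used: on norm
   bounded sets of Lip_0, [mu] is continuous for pointwise convergence. *)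
Definition tight mu : Prop := forall e : R, 0 < e ->
  exists (s : seq M) (A : R), 0 <= A /\
    forall (f : lip0 M) (eta : R), 0 <= eta ->
      (forall x, x \in s -> `|f x| <= eta) -> `|mu f| <= e * `|f| + A * eta.

(** Take a finite combination [nu] of evaluations within [e] of [mu]: [s] lists its points and [A]
    sums the absolute values of its coefficients. *)
Lemma tight_lip_free mu : lip_free M mu -> tight mu.
Proof.
move=> mufree e e0.
have [_ [[n [c [x ->]]] munu]] := mufree _ (nbhsx_ballx mu e e0).
set nu := \sum_(i < n) _ in munu.
exists [seq x i | i <- enum 'I_n], (\sum_(i < n) `|c i|); split.
  by apply: sumr_ge0 => i _.
move=> f eta eta0 feta.
have -> : mu f = dual_fun (mu - nu) f + dual_fun nu f.
  by rewrite -[X in _ = X + _]/(mu f - dual_fun nu f) subrK.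
rewrite (le_trans (ler_normD _ _))// lerD//.
  rewrite (le_trans (dual_normP _ _))// ler_wpM2r//.
  by move: munu; rewrite -ball_normE => /ltW.
have -> : dual_fun nu f = \sum_(i < n) c i * f (x i).
  by apply: (big_morph (fun mu : dual _ => dual_fun mu f)).
rewrite mulr_suml (le_trans (ler_norm_sum _ _ _))// ler_sum// => i _.
by rewrite normrM ler_wpM2l// feta// map_f// mem_enum.
Qed.

Lemma tightD (a : R) mu nu : tight mu -> tight nu -> tight (a *: mu + nu).
Proof.
move=> mut nut e e0.
have [|s [A [A0 mus]]] := mut (e / 2 / (`|a| + 1)).
  by rewrite !divr_gt0 ?ltr_wpDl.
have [|t [B [B0 nus]]] := nut (e / 2); first by rewrite divr_gt0.
exists (s ++ t), (`|a| * A + B); split=> [|f eta eta0 feta].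
  by rewrite addr_ge0 ?mulr_ge0.
rewrite -[dual_fun _ f]/(a * mu f + nu f) (le_trans (ler_normD _ _))// normrM.
have {mus}/mus : forall x, x \in s -> `|f x| <= eta.
  by move=> x xs; apply: feta; rewrite mem_cat xs.
move=> /(_ eta0) mus.
have {nus}/nus : forall x, x \in t -> `|f x| <= eta.
  by move=> x xs; apply: feta; rewrite mem_cat xs orbT.
move=> /(_ eta0) nus.
have : `|a| * `|mu f| <= `|a| * (e / 2 / (`|a| + 1) * `|f| + A * eta).
  by rewrite ler_wpM2l.
have : `|a| * (e / 2 / (`|a| + 1) * `|f|) <= e / 2 * `|f|.
  rewrite mulrA ler_wpM2r// mulrCA ler_piMr ?divr_ge0 ?ltW//.
  by rewrite ltr_pdivrMr ?mul1r ?ltrDl// ltr_wpDl.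
by move=> *; lra.
Qed.

Lemma tight_approx mu g K : tight mu -> lip_consts g K ->
  mu (recenter g) != 0 ->
  exists (s : seq M) (eta : R), 0 < eta /\
    forall t, lip_consts t K -> (forall x, x \in s -> `|t x - g x| <= eta) ->
      mu (recenter t) != 0.
Proof.
move=> mut gK; rewrite -normr_gt0; set c := `|_| => c0.
have K0 : 0 <= K by case: gK.
have [|s [A [A0 mus]]] := mut (c / 2 / (K + K + 1)).
  by rewrite !divr_gt0// ltr_wpDl ?addr_ge0.
have eta0 : 0 < c / 8 / (A + 1) by rewrite !divr_gt0// ltr_wpDl.
(* The base point is included because recentring subtracts the value there. The recentred functions
   then differ on [s] by at most twice the tolerance, and the two error terms are at most [c / 2]
   and [c / 4]. *)
exists (point :: s), (c / 8 / (A + 1)); split=> // t tK tg.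
apply/eqP => mut0.
have mutg : mu (recenter t - recenter g) = - mu (recenter g).
  by rewrite linearB/= mut0 sub0r.
have eta2 : 0 <= 2 * (c / 8 / (A + 1)) by rewrite mulr_ge0// ltW.
have := mus (recenter t - recenter g) _ eta2; rewrite mutg normrN -/c => cle.
have {cle}/cle : forall x, x \in s ->
    `|lip0_fun (recenter t - recenter g) x| <= 2 * (c / 8 / (A + 1)).
  move=> x xs; rewrite -[lip0_fun _ x]/(recenter t x - recenter g x).
  rewrite (recenterE _ tK) (recenterE _ gK).
  have := tg x; rewrite inE xs orbT => /(_ isT).
  have := tg point; rewrite inE eqxx => /(_ isT).
  by rewrite !ler_norml; lra.
have : c / 2 / (K + K + 1) * `|recenter t - recenter g| <= c / 2.
  rewrite -mulrA ler_piMr ?divr_ge0 ?(ltW c0)// mulrC ler_pdivrMr ?ltr_wpDl ?addr_ge0//.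
  rewrite mul1r (le_trans (ler_normB _ _))// ler_wpDr// lerD//.
    exact: norm_recenter_le.
  exact: norm_recenter_le.
have : A * (2 * (c / 8 / (A + 1))) <= c / 4.
  have -> : A * (2 * (c / 8 / (A + 1))) = c / 4 * (A / (A + 1)).
    by field; rewrite gt_eqF// ltr_wpDl.
  by rewrite ler_piMr ?divr_ge0 ?(ltW c0)// ler_pdivrMr ?ltr_wpDl// mul1r lerDl.
lra.
Qed.

Definition tent r (p x : M) : R := Num.max 0 (1 - mdist p x / r).

Definition tents r (s : seq M) (x : M) : R :=
  foldr (fun p m => Num.max (tent r p x) m) 0 s.

Lemma lip_consts_tent r p : 0 < r -> lip_consts (tent r p) r^-1.
Proof.
move=> r0; apply: lip_consts_max.
  by apply: lip_consts_le (lip_consts_cst 0); rewrite invr_ge0 ltW.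
split=> [|x y]; first by rewrite invr_ge0 ltW.
have [_ /(_ x y)] := lip_consts_mdist p.
rewrite mul1r => dxy.
have -> : 1 - mdist p x / r - (1 - mdist p y / r) =
  (- mdist p x - - mdist p y) / r by ring.
by rewrite normrM (@ger0_norm _ r^-1) ?invr_ge0 ?(ltW r0)// mulrC ler_wpM2l// invr_ge0 ltW.
Qed.

Lemma tent_ge0_le1 r p x : 0 < r -> 0 <= tent r p x <= 1.
Proof.
move=> r0; rewrite /tent le_max lexx/= ge_max ler01/= gerBl divr_ge0 ?mdist_ge0//.
exact: ltW.
Qed.

Lemma lip_consts_tents r s : 0 < r -> lip_consts (tents r s) r^-1.
Proof.
move=> r0; elim: s => [|p s IH].
  by apply: lip_consts_le (lip_consts_cst 0); rewrite invr_ge0 ltW.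
exact: lip_consts_max (lip_consts_tent p r0) IH.
Qed.

Lemma tents_ge0_le1 r s x : 0 < r -> 0 <= tents r s x <= 1.
Proof.
move=> r0; elim: s => [|p s /andP[IH0 IH1]] /=; first by rewrite lexx ler01.
by rewrite le_max IH0 orbT ge_max IH1 andbT; case/andP: (tent_ge0_le1 p x r0).
Qed.

Lemma tents_mem r s x : 0 < r -> x \in s -> tents r s x = 1.
Proof.
move=> r0 xs; apply/eqP; rewrite eq_le; case/andP: (tents_ge0_le1 s x r0) => _ ->/=.
elim: s xs => //= p s IH; rewrite inE le_max => /orP[/eqP<-|/IH->]; last by rewrite orbT.
by rewrite /tent mdistxx mul0r subr0 le_max lexx orbT.
Qed.

(** The height [b] is fixed while the Lipschitz constant merely exists: localization preserves the
    former and worsens the latter. *)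
Definition detected mu b g : Prop :=
  [/\ forall x, 0 <= g x <= b, exists K, lip_consts g K & mu (recenter g) != 0].

(** If [mu] already detects the product with the maximum over the shorter list, induct; otherwise it
    detects [g] times the increment due to [p], which vanishes outside the ball of radius [r] around
    [p]. *)
Lemma detected_tents mu b g r s : 0 < r -> (forall x, 0 <= g x <= b) ->
  (exists K, lip_consts g K) ->
  mu (recenter (fun x => g x * tents r s x)) != 0 ->
  exists p g', detected mu b g' /\
    forall x, g' x != 0 -> g x != 0 /\ mdist p x < r.
Proof.
move=> r0 gb [K gK]; elim: s => [|p s IH].
  suff -> : (fun x => g x * tents r [::] x) = fun _ : M => 0.
    by rewrite recenter_cst linear0 eqxx.
  by apply/funext => x; rewrite mulr0.
have [mus|/IH//] := eqVneq (mu (recenter (fun x => g x * tents r s x))) 0.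
move=> mups; pose phi x := tents r (p :: s) x + - tents r s x.
have phi01 x : 0 <= phi x <= 1.
  rewrite /phi /=.
  have /andP[? ?] := tents_ge0_le1 s x r0; have /andP[? ?] := tent_ge0_le1 p x r0.
  by case: (leP (tent r p x) (tents r s x)) => ?; apply/andP; split; lra.
have tsK t := lip_consts_tents t r0.
exists p, (fun x => g x * phi x); split; first split.
- move=> x; have /andP[p0 p1] := phi01 x; have /andP[g0 g1] := gb x.
  by rewrite mulr_ge0//= (le_trans _ g1)// ler_piMr.
- exists (K + b * (r^-1 + r^-1)); apply: lip_constsM => //.
  by apply: lip_constsD => //; apply: lip_constsN.
- have -> : (fun x => g x * phi x) =
      (fun x => g x * tents r (p :: s) x + - (g x * tents r s x)).
    by apply/funext => x; rewrite /phi mulrDr mulrN.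
  have gs t := lip_constsM gK (tsK t) gb (fun x => tents_ge0_le1 t x r0).
  rewrite (recenterD (gs _) (lip_constsN (gs _))) (recenterN (gs _)).
  by rewrite linearB/= mus subr0.
- move=> x; rewrite mulf_eq0 negb_or => /andP[-> phi0]; split=> //.
  rewrite ltNge; apply/negP => rp; move/eqP: phi0; apply.
  have p0 : tent r p x = 0 by apply/max_idPl; rewrite subr_le0 ler_pdivlMr// mul1r.
  rewrite /phi /= p0; case/andP: (tents_ge0_le1 s x r0) => /max_idPr -> _.
  by rewrite subrr.
Qed.

Lemma detected_localize mu b g r : tight mu -> 0 < r -> detected mu b g ->
  exists p g', detected mu b g' /\
    forall x, g' x != 0 -> g x != 0 /\ mdist p x < r.
Proof.
move=> mut r0 [gb [K gK] mug].
have K0 : 0 <= K by case: gK.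
have b0 : 0 <= b by have /andP[/le_trans] := gb point; apply.
have L0 : 0 <= K + b * r^-1 by rewrite addr_ge0 ?mulr_ge0 ?invr_ge0 ?(ltW r0).
move: (mug); rewrite -normr_gt0; set c := `|_| => c0.
have [|s [A [A0 mus]]] := mut (c / 2 / (K + b * r^-1 + 1)).
  by rewrite !divr_gt0// ltr_wpDl.
apply: (@detected_tents mu b g r (point :: s) r0 gb); first by exists K.
set t := tents r _.
have tK : lip_consts t r^-1 by exact: lip_consts_tents.
have t1 x : x \in point :: s -> t x = 1 by exact: tents_mem.
have t01 x : 0 <= t x <= 1 by exact: tents_ge0_le1.
pose h x := g x * (1 - t x).
have hK : lip_consts h (K + b * r^-1).
  apply: lip_constsM => //; last by move=> x; have := t01 x; lra.
  by rewrite -[r^-1]add0r; apply: lip_constsD (lip_consts_cst 1) (lip_constsN tK).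
have -> : (fun x => g x * t x) = (fun x => g x + - h x).
  by apply/funext => x; rewrite /h; ring.
rewrite (recenterD gK (lip_constsN hK)) (recenterN hK) linearB/= subr_eq0.
apply/eqP => gh.
(* Tightness is used with [eta = 0]: [h] vanishes on [s] and at the base point, since the tents
   equal 1 there. *)
have := mus (recenter h) 0 (lexx _); rewrite mulr0 addr0 -gh -/c => cle.
have {cle}/cle : forall x, x \in s -> `|recenter h x| <= 0.
  move=> x xs; rewrite (recenterE _ hK) /h !t1 ?inE ?eqxx ?xs ?orbT//.
  by rewrite !subrr !mulr0 subrr normr0.
apply/negP; rewrite -ltNge (@le_lt_trans _ _ (c / 2))//; last by lra.
rewrite -[leLHS]mulrA ler_piMr ?divr_ge0 ?(ltW c0)// mulrC.
rewrite ltW// ltr_pdivrMr ?ltr_wpDl// mul1r (le_lt_trans (norm_recenter_le hK))//.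
by rewrite ltrDl.
Qed.

Lemma detected_neq0 mu b g : detected mu b g -> exists x, g x != 0.
Proof.
move=> [_ _ mug]; apply: contrapT => g0; case/negP: mug.
suff -> : g = fun _ : M => 0 by rewrite recenter_cst linear0.
by apply/funext => x; apply: contrapT => /eqP gx; apply: g0; exists x.
Qed.

End tight.

(** * Concentration of a functional at a point *)

Section concentration.
Context {R : realType}.

(** The Cauchy condition lets the centre [p] vary with [e], which is what the nested supports below
    provide. *)
Definition sequentially_complete (M : pMetricType R) : Prop :=
  forall x : nat -> M,
    (forall e : R, 0 < e ->
      exists p n, forall m, (n <= m)%N -> mdist p (x m) < e) ->
    exists l : M, forall e : R, 0 < e ->
      exists n, forall m, (n <= m)%N -> mdist l (x m) < e.

Lemma completeMetric_sequentially_complete (M : completeMetricType R) :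
  sequentially_complete M.
Proof.
move=> x xC.
have /cauchy_cvg xl : cauchy (x @ \oo).
  apply: cauchy_exP => e e0; have [p [n xn]] := xC e e0.
  by exists p; exists n => // m /= nm; rewrite ballEmdist; exact: xn.
exists (lim (x @ \oo)) => e e0.
have [n _ xn] := xl _ (nbhsx_ballx (lim (x @ \oo)) e e0).
by exists n => m /xn; rewrite /= ballEmdist.
Qed.

Context {M : pMetricType R}.
Hypothesis Mc : sequentially_complete M.

Lemma concentration (mu : dual (lip0 M)) (b : R) (g0 : M -> R) :
  tight mu -> detected mu b g0 ->
  exists x, forall rho : R, 0 < rho -> exists g, detected mu b g /\
    forall y, g y != 0 -> mdist x y < rho.
Proof.
move=> mut mug0.
have /choice[step stepP] (ng : nat * (M -> R)) : exists pg : M * (M -> R),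
    detected mu b ng.2 -> detected mu b pg.2 /\
      forall x, pg.2 x != 0 -> ng.2 x != 0 /\ mdist pg.1 x < ng.1.+1%:R^-1.
  have [mug|] := pselect (detected mu b ng.2); last by exists (point, ng.2).
  have [|p [g' ?]] := @detected_localize _ _ mu b ng.2 ng.1.+1%:R^-1 mut _ mug.
    by rewrite invr_gt0.
  by exists (p, g').
pose G n := iteri n (fun k g => (step (k, g)).2) g0.
pose p n := (step (n, G n)).1.
have GP n : detected mu b (G n).
  by elim: n => // n IH; have [] := stepP (n, G n) IH.
have Gp n x : G n.+1 x != 0 -> mdist (p n) x < n.+1%:R^-1.
  by have [_ /(_ x) H] := stepP (n, G n) (GP n) => /H[].
have Gsub m n x : G (n + m)%N x != 0 -> G n x != 0.
  elim: m => [|m IH]; first by rewrite addn0.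
  rewrite addnS => Gx; apply: IH.
  by have [_ /(_ x Gx)[]] := stepP ((n + m)%N, G (n + m)%N) (GP _).
(* Any choice of points in the supports of the [G n] is Cauchy: the supports are nested, and that of
   [G n.+1] lies in the ball of radius [n.+1%:R^-1] around [p n]. *)
have /choice[x xP] n := detected_neq0 (GP n).
have px n m : (n < m)%N -> mdist (p n) (x m) < n.+1%:R^-1.
  move=> nm; apply: Gp; apply: (Gsub (m - n.+1)%N).
  by rewrite subnKC//; exact: xP.
have [|l xl] := Mc (x := x).
  move=> e e0; have [n ne] := natSinv_lt e0.
  by exists (p n), n.+1 => m nm; apply: lt_trans ne; exact: px.
exists l => rho rho0.
(* The path from [l] to [y] goes through a late [x m] and then [p n], each of its three legs being
   shorter than [rho / 3]. *)
have [|n nrho] := @natSinv_lt R (rho / 3); first by rewrite divr_gt0.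
exists (G n.+1); split=> // y /Gp py.
have [|m xm] := xl (rho / 3); first by rewrite divr_gt0.
have := xm (maxn m n.+1) (leq_maxl _ _) => lx.
have := px n (maxn m n.+1) (leq_maxr _ _); rewrite metric_sym => xp.
have {}py := lt_trans py nrho; have {}xp := lt_trans xp nrho.
have := metric_triangle l (x (maxn m n.+1)) y.
have := metric_triangle (x (maxn m n.+1)) (p n) y.
by move=> *; lra.
Qed.

End concentration.

(** * Interpolation on finitely many functionals *)

Section interpolation.
Context {R : realType} {V : normedModType R}.
Variable P : dual V -> Prop.
Hypothesis P0 : P 0.
Hypothesis PD : forall (a : R) mu nu, P mu -> P nu -> P (a *: mu + nu).
Implicit Types (S : set V) (mu nu : dual V) (s : seq (dual V)).

Lemma dual_fun_linear (a : R) mu nu v :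
  dual_fun (a *: mu + nu) v = (a : R) * (mu v : R) + (nu v : R) :> R.
Proof. by []. Qed.

Lemma dual_linearP mu (a : R) u v : mu (a *: u + v) = a * (mu u : R) + (mu v : R) :> R.
Proof. exact: linearP. Qed.

Lemma dual_linear0 mu : mu 0 = 0 :> R. Proof. exact: linear0. Qed.

Lemma dual_linearB mu u v : mu (u - v) = (mu u : R) - (mu v : R) :> R.
Proof. exact: linearB. Qed.

Definition subspace_set S := S 0 /\ forall (a : R) u v, S u -> S v -> S (a *: u + v).

(** Relative form of the fact that a functional vanishing on a common kernel is a linear
    combination. The combination [lam] is remembered only through [P] and its own vanishing. [S]
    varies because the induction cuts it by the kernel of [nu]. *)
Lemma vanishing_on_kernels S s mu : subspace_set S ->
  (forall nu, nu \in s -> P nu) ->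
  (forall v, S v -> (forall nu, nu \in s -> nu v = 0 :> R) -> mu v = 0 :> R) ->
  exists lam : dual V, [/\ P lam,
    forall u, (forall nu, nu \in s -> nu u = 0 :> R) -> lam u = 0 :> R &
    forall v, S v -> mu v = lam v :> R].
Proof.
elim: s S => [|nu s IH] S SS sP smu.
  by exists 0; split=> // v Sv; rewrite smu.
have {}sP' nu' : nu' \in s -> P nu'.
  by move=> nu's; apply: sP; rewrite inE nu's orbT.
have [[v0 [Sv0 /eqP nuv0]]|nuS] := pselect (exists v0, S v0 /\ nu v0 <> 0 :> R).
- have S1S : subspace_set [set v | S v /\ nu v = 0 :> R].
    case: SS => S0 SD; split=> [|a u v [Su nu0] [Sv nv0]] /=.
      by rewrite dual_linear0.
    by split; [exact: SD|rewrite dual_linearP nu0 nv0 mulr0 addr0].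
  have [|lam [Plam lams lamS]] := IH _ S1S sP'.
    move=> v [Sv nuv] sv; apply: smu => // nu'.
    by rewrite inE => /orP[/eqP->|/sv].
  (* The coefficient gives agreement with [mu] at [v0], which together with the kernel of [nu] in
     [S] spans [S]. *)
  exists (((mu v0 - lam v0) / nu v0) *: nu + lam); split.
  + by apply: PD => //; apply: sP; rewrite mem_head.
  + move=> u us; rewrite dual_fun_linear us ?mem_head// mulr0 add0r lams// => nu' nu's.
    by rewrite us// inE nu's orbT.
  + move=> v Sv; rewrite dual_fun_linear.
    have /lamS : S (- (nu v / nu v0) *: v0 + v) /\
        nu (- (nu v / nu v0) *: v0 + v) = 0 :> R.
      split; first by case: SS => _; apply.
      by rewrite dual_linearP mulNr divfK// addNr.
    rewrite !dual_linearP => muv.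
    have -> : mu v = nu v / nu v0 * mu v0 + (- (nu v / nu v0) * mu v0 + mu v).
      by rewrite mulNr addNKr.
    by rewrite muv; field.
- have nuS0 v : S v -> nu v = 0 :> R.
    by move=> Sv; apply: contrapT => nuv; apply: nuS; exists v.
  have [|lam [Plam lams lamS]] := IH _ SS sP'.
    move=> v Sv sv; apply: smu => // nu'.
    by rewrite inE => /orP[/eqP->|/sv//]; rewrite nuS0.
  exists lam; split=> // u us; apply: lams => nu' nu's.
  by rewrite us// inE nu's orbT.
Qed.

(** The value at [mu] is corrected along a vector of [S] killed by [s]. Without such a vector, [mu]
    agrees on [S], hence everywhere by separation, with a functional vanishing on the common kernel
    of [s], so the previous [g] already works. *)
Lemma interpolation S s f : subspace_set S ->
  (forall mu, P mu -> (forall v, S v -> mu v = 0 :> R) -> forall v, mu v = 0 :> R) ->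
  (forall mu, mu \in s -> P mu) ->
  exists2 g, S g & forall mu : dual V, mu \in s -> mu g = mu f :> R.
Proof.
move=> SS Ssep; elim: s => [|mu s IH] sP; first by exists 0; first by case: SS.
have Pmu : P mu by apply: sP; rewrite mem_head.
have sP' nu : nu \in s -> P nu by move=> nus; apply: sP; rewrite inE nus orbT.
have [g Sg gf] := IH sP'.
have [[v [Sv sv /eqP muv]]|smu] :=
    pselect (exists v, [/\ S v, forall nu, nu \in s -> nu v = 0 :> R & mu v <> 0 :> R]).
  exists (((mu f - mu g) / mu v) *: v + g); first by case: SS => _; apply.
  move=> nu; rewrite inE dual_linearP => /orP[/eqP->|nus].
    by rewrite divfK// subrK.
  by rewrite (sv _ nus) mulr0 add0r gf.
have [|lam [Plam lams lamS]] := @vanishing_on_kernels S s mu SS sP'.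
  by move=> v Sv sv; apply: contrapT => muv; apply: smu; exists v.
have mulam v : mu v = lam v :> R.
  apply/eqP; rewrite -subr_eq0 addrC -mulN1r -dual_fun_linear; apply/eqP.
  apply: Ssep => [|w Sw]; first exact: PD.
  by rewrite dual_fun_linear mulN1r lamS// addNr.
exists g => // nu; rewrite inE => /orP[/eqP->|/gf//].
rewrite !mulam; apply/eqP; rewrite -subr_eq0 -dual_linearB; apply/eqP.
by apply: lams => nu' nu's; rewrite dual_linearB gf// subrr.
Qed.

End interpolation.

(** * Rational combinations of a countable family *)

Section rational_span.
Context {R : realType} {V : normedModType R} {I : countType} (t : I -> V).
Implicit Types (s : seq (dual V)).

Definition rational_span : set V :=
  range (fun l : seq (rat * I) => \sum_(p <- l) (ratr p.1 : R) *: t p.2).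

Lemma countable_rational_span : countable rational_span.
Proof. exact: sub_countable (card_image_le _ _) (countableP _). Qed.

Lemma rational_spanP (q : rat) u v : rational_span u -> rational_span v ->
  rational_span ((ratr q : R) *: u + v).
Proof.
move=> [l _ <-] [l' _ <-]; exists ([seq (q * p.1, p.2) | p <- l] ++ l') => //.
rewrite big_cat big_map scaler_sumr; congr (_ + _).
by apply: eq_bigr => p _; rewrite scalerA rmorphM.
Qed.

Definition weak_closure : set V := [set g | forall s (e : R), 0 < e ->
  exists2 d, rational_span d & forall mu : dual V, mu \in s -> `|mu d - mu g| < e].

Lemma weak_closure_gen i : weak_closure (t i).
Proof.
move=> s e e0; exists (t i); last by move=> mu _; rewrite subrr normr0.
by exists [:: (1, i)] => //; rewrite big_seq1 rmorph1 scale1r.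
Qed.

Lemma ex_bound s (u : V) :
  exists2 B : R, 0 < B & forall mu : dual V, mu \in s -> `|mu u| < B.
Proof.
exists (1 + \sum_(mu <- s) `|mu u|); first by rewrite ltr_wpDr// sumr_ge0.
elim: s => // mu s IH nu; rewrite inE big_cons => /orP[/eqP->|/IH nus].
  by rewrite addrCA ltrDl ltr_wpDr// sumr_ge0.
by rewrite (lt_le_trans nus)// lerD2l lerDr.
Qed.

Lemma subspace_weak_closure : subspace_set weak_closure.
Proof.
split=> [s e e0|a u v uS vS s e e0].
  exists 0; last by move=> mu _; rewrite subrr normr0.
  by exists [::] => //; rewrite big_nil.
(* With [B] bounding all functionals of [s] at [u], replacing [a] by a rational within [e / 3 / B]
   costs less than [e / 3]. *)
have [B B0 uB] := ex_bound s u.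
have e3 : 0 < e / 3 by rewrite divr_gt0.
have [|q qa] := @rat_in_itvoo R a (a + e / 3 / B).
  by rewrite ltrDl divr_gt0.
have q0 : 0 < `|ratr q : R| + 1 by rewrite ltr_wpDl.
have [|du duD du_e] := uS s (e / 3 / (`|ratr q| + 1)); first by rewrite divr_gt0.
have [|dv dvD dv_e] := vS s (e / 3); first by [].
exists ((ratr q : R) *: du + dv); first exact: rational_spanP.
move=> mu mus; rewrite !dual_linearP.
have -> : ratr q * mu du + mu dv - (a * mu u + mu v) =
  ratr q * (mu du - mu u) + (ratr q - a) * mu u + (mu dv - mu v) by ring.
rewrite (le_lt_trans (ler_normD _ _))//.
have -> : e = e / 3 + e / 3 + e / 3 by field.
rewrite ltrD ?dv_e// (le_lt_trans (ler_normD _ _))// ler_ltD//.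
  rewrite normrM (le_trans (ler_wpM2l _ (ltW (du_e _ mus))))//.
  by rewrite mulrCA ler_piMr ?(ltW e3)// ler_pdivrMr// mul1r lerDl.
move: qa; rewrite in_itv/= => /andP[aq qa].
rewrite normrM (@ger0_norm _ (ratr q - a)) ?subr_ge0 ?ltW//.
have qaB : ratr q - a <= e / 3 / B by rewrite lerBlDl ltW.
rewrite (le_lt_trans (ler_wpM2r _ qaB))//.
by rewrite -[ltRHS](divfK (lt0r_neq0 B0)) ltr_pM2l ?divr_gt0// uB.
Qed.

End rational_span.

(** * From separating families to separability *)

Section wstar.
Context {R : realType} {M : pMetricType R}.

Lemma tight0 : tight (0 : dual (lip0 M)).
Proof.
move=> e e0; exists [::], 0; split=> // f eta eta0 _.
by rewrite mul0r addr0 -[dual_fun 0 f]/(0 : R) normr0 mulr_ge0 ?(ltW e0).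
Qed.

Lemma wstar_open_basis (O : set (lip0_wstar M)) (f : lip0 M) : open O -> O f ->
  exists (s : seq (dual (lip0 M))) (e : R),
    [/\ 0 < e, forall mu : dual (lip0 M), mu \in s -> lip_free M mu &
      forall g : lip0 M,
        (forall mu : dual (lip0 M), mu \in s -> `|mu g - mu f| < e) -> O g].
Proof.
move=> [A Aop <-] Af.
pose ev (g : lip0 M) : {ptws lip_free M -> R^o} := fun mu => \val mu g.
pose B (p : seq (lip_free M) * R) : set {ptws lip_free M -> R^o} :=
  [set h | forall mu, mu \in p.1 -> `|h mu - ev f mu| < p.2].
pose F := filter_from [set p : seq (lip_free M) * R | 0 < p.2] B.
have FF : Filter F.
  apply: filter_from_filter; first by exists ([::], 1) => /=.
  move=> [s e] [s' e'] /= e0 e'0.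
  exists (s ++ s', Num.min e e'); first by rewrite /= lt_min e0.
  move=> h /= hB; split=> mu /= mus.
    by have := hB mu; rewrite mem_cat mus lt_min => /(_ isT)/andP[].
  by have := hB mu; rewrite mem_cat mus orbT lt_min => /(_ isT)/andP[].
have Fcvg : {ptws, F --> ev f}.
  apply/pointwise_cvgP => mu U /nbhs_ballP[e /= e0 eU].
  exists ([:: mu], e) => // h /= hB; apply: eU.
  by rewrite -ball_normE /= distrC; apply: hB; rewrite mem_head.
have [[s e] /= e0 BA] := Fcvg A (open_nbhs_nbhs (conj Aop Af)).
exists [seq \val mu | mu <- s], e; split=> //.
  by move=> _ /mapP[mu _ ->]; have := valP mu; rewrite inE.
by move=> g gs; apply: BA => mu mus; apply: gs; apply: map_f.
Qed.

(** Interpolation needs a real subspace, so it is done in the weak closure of the rational span; the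
    interpolant, exact on [s], is then approximated by a rational combination. *)
Lemma separating_separable (I : countType) (t : I -> lip0 M) :
  (forall mu : dual (lip0 M), tight mu -> (forall i, mu (t i) = 0) ->
    forall f, mu f = 0) ->
  separable (lip0_wstar M).
Proof.
move=> tsep; exists (rational_span t : set (lip0_wstar M)).
  exact: countable_rational_span.
move=> O [f Of] Oop; have [s [e [e0 sF sO]]] := wstar_open_basis Oop Of.
have [mu mut muS|mu mus|g gS gf] := @interpolation R (lip0 M) (@tight R M) tight0
  (@tightD R M) (weak_closure t) s f (subspace_weak_closure t).
- apply: tsep => // i; apply: muS.
  exact: weak_closure_gen.
- by apply: tight_lip_free; exact: sF.
have [d dD dg] := gS s e e0.
by exists d; split=> //; apply: sO => mu mus; rewrite -(gf _ mus) dg.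
Qed.

End wstar.

(** * Chains between centres of separable balls *)

Section chains.
Context {R : realType} {M : pMetricType R}.
Implicit Types (r : R) (x y z : M).

(** The points [e j] may lie outside the ball, so the same [e] serves for any ball contained in
    it. *)
Definition separable_ball r x : Prop :=
  exists e : nat -> M, forall y, mdist x y < r ->
    forall eps : R, 0 < eps -> exists j, mdist (e j) y < eps.

Definition step r x y : Prop :=
  [/\ separable_ball r x, separable_ball r y & mdist x y < r].

(* By the restriction to centres of separable balls, every class is separable;
   distinct classes of such centres lie at distance at least [r]. *)
Definition chained r : M -> M -> Prop := clos_refl_sym_trans M (step r).

Lemma separable_ball_chained r x y :
  chained r x y -> (separable_ball r x <-> separable_ball r y).
Proof.
by elim=> [{}x {}y []//|//|{}x {}y _ ->//|{}x {}y z _ -> _ ->].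
Qed.

Lemma stepC r x y : step r x y -> step r y x.
Proof. by move=> [? ? xy]; split; rewrite // metric_sym. Qed.

Lemma dense_steps r : exists s : M -> nat * nat -> M,
  (forall x j, chained r x (s x j)) /\
  forall x y, step r x y -> forall eps : R, 0 < eps ->
    exists j, mdist (s x j) y < eps.
Proof.
suff /choice[s sP] x : exists s : nat * nat -> M,
    (forall j, chained r x (s j)) /\
    forall y, step r x y -> forall eps : R, 0 < eps ->
      exists j, mdist (s j) y < eps.
  by exists s; split=> x; case: (sP x).
have [[e eP]|nsx] := pselect (separable_ball r x); last first.
  by exists (fun=> x); split=> [j|y []//]; exact: rst_refl.
(* [e j.1] may lie outside the class of [x]; it is replaced by a point one step from [x] and within
   [j.2.+1%:R^-1] of it, or by [x] when there is none. *)
have /choice[s sP] (j : nat * nat) : exists z, chained r x z /\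
    ((exists y, step r x y /\ mdist (e j.1) y < j.2.+1%:R^-1) ->
      mdist (e j.1) z < j.2.+1%:R^-1).
  have [[y [xy ey]]|ny] :=
      pselect (exists y, step r x y /\ mdist (e j.1) y < j.2.+1%:R^-1).
    by exists y; split=> //; exact: rst_step.
  by exists x; split=> //; exact: rst_refl.
exists s; split=> [j|y xy eps eps0]; first by case: (sP j).
have [|k keps] := @natSinv_lt R (eps / 2); first by rewrite divr_gt0.
have [_ _ /eP/(_ k.+1%:R^-1)] := xy.
rewrite invr_gt0 ltr0n => /(_ isT)[i ey]; exists (i, k).
have [_ /(_ (ex_intro _ y (conj xy ey)))/= es] := sP (i, k).
have := metric_triangle (s (i, k)) (e i) y.
have {}ey := lt_trans ey keps; have {}es := lt_trans es keps.
by rewrite metric_sym in es; move=> *; lra.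
Qed.

Definition rep r x : M := xget point [set y | chained r x y].

Lemma rep_chained r x : chained r x (rep r x).
Proof.
by apply: (@xgetPex _ point [set y | chained r x y]); exists x; exact: rst_refl.
Qed.

Lemma eq_rep r x y : chained r x y -> rep r x = rep r y.
Proof.
move=> xy; congr (xget point _); apply/seteqP; split=> z /= H.
  by apply: rst_trans H; exact: rst_sym.
exact: rst_trans H.
Qed.

End chains.

(** * Test functions at a fixed scale *)

Section tests.
Context {R : realType} {M : pMetricType R} {r : R}.
Context {s : M -> nat * nat -> M} {code : M -> nat -> bool}.
Hypothesis r0 : 0 < r.
Hypothesis s_chained : forall x j, chained r x (s x j).
Hypothesis s_dense : forall x y, step r x y -> forall eps : R, 0 < eps ->
  exists j, mdist (s x j) y < eps.
Hypothesis code_chained : forall x y, separable_ball r x -> separable_ball r y ->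
  code x = code y <-> chained r x y.

Definition walk (x : M) (w : seq (nat * nat)) : M := foldr (fun j y => s y j) x w.

Lemma walk_chained x w : chained r x (walk x w).
Proof.
by elim: w => [|j w IH]; [exact: rst_refl|exact: rst_trans IH (s_chained _ _)].
Qed.

(** Approximability by walks passes along a step from [a] to [b]: a walk ending within
    [r - mdist a b] of [a] is within [r] of [b], so one more move approximates [b]. *)
Lemma walk_dense x y : separable_ball r x -> chained r x y ->
  forall eps : R, 0 < eps -> exists w, mdist (walk x w) y < eps.
Proof.
move=> Ax; pose near_walk y := forall eps : R, 0 < eps ->
  exists w, mdist (walk x w) y < eps.
have near_step a b : step r a b -> near_walk a -> near_walk b.
  move=> [Aa Ab ab] an eps eps0.
  have [|w wa] := an (r - mdist a b); first by rewrite subr_gt0.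
  have [|j jb] := @s_dense (walk x w) b _ eps eps0; last by exists (j :: w).
  split=> //; first by rewrite -(separable_ball_chained (walk_chained x w)).
  by rewrite (le_lt_trans (metric_triangle _ a _))// -ltrBrDr.
have nearE a b : chained r a b -> (near_walk a <-> near_walk b).
  elim=> [a' b' ab|//|a' b' _ ->//|a' b' c _ -> _ ->//].
  by split; apply: near_step => //; exact: stepC.
move=> /nearE[+ _]; apply => eps eps0.
by exists [::]; rewrite mdistxx.
Qed.

(* Capping the height at [L * r / 2] confines the support to the open ball of
   radius [r / 2] around [p], so that cones attached to different classes have
   disjoint supports. *)
Definition cone (L : nat) (q : R) (p y : M) : R :=
  Num.max 0 (Num.min q (L%:R * r / 2) - L%:R * mdist p y).

Lemma lip_consts_cone L q p : lip_consts (cone L q p) L%:R.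
Proof.
apply: lip_consts_max; first exact: lip_consts_le (ler0n _ _) (lip_consts_cst 0).
split=> [|x y]; first exact: ler0n.
have [_ /(_ x y)] := lip_consts_mdist p; rewrite mul1r => dxy.
rewrite opprB addrC addrA subrK -mulrBr normrM ger0_norm ?ler0n// ler_wpM2l//.
by rewrite (le_trans _ dxy)// opprK addrC.
Qed.

(* The same finite pattern of cones [i.1.2] is copied in all the classes whose
   code extends the finite word [i.2]; longer words isolate a class as seen from
   finitely many points. *)
Definition test_values (i : nat * seq (seq (nat * nat) * rat) * seq bool)
    (y : M) : set R :=
  [set v | v = 0 \/ exists z wq, [/\ separable_ball r z,
    forall j, (j < size i.2)%N -> code z j = nth false i.2 j,
    wq \in i.1.2 & v = cone i.1.1 (ratr wq.2) (walk (rep r z) wq.1) y]].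

Definition test i (y : M) : R := sup (test_values i y).

Lemma test_values_le i y v : test_values i y v -> v <= i.1.1%:R * r / 2.
Proof.
have B0 : 0 <= i.1.1%:R * r / 2 by rewrite divr_ge0// mulr_ge0// ltW.
move=> [->//|[z [wq [_ _ _ ->]]]]; rewrite /cone ge_max B0/=.
by rewrite lerBlDr ge_min lerDl mulr_ge0 ?mdist_ge0 ?orbT.
Qed.

Lemma lip_consts_test i : lip_consts (test i) i.1.1%:R.
Proof.
apply: (@lip_consts_sup _ M (test_values i) _ (i.1.1%:R * r / 2)) => //.
- by move=> x; exists 0; left.
- by move=> x z; exact: test_values_le.
- move=> x y v [->|[z [wq [Az zi wqi ->]]]].
    by exists 0; [left|rewrite add0r mulr_ge0 ?mdist_ge0].
  exists (cone i.1.1 (ratr wq.2) (walk (rep r z) wq.1) y).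
    by right; exists z, wq.
  have [_ /(_ x y)] := lip_consts_cone i.1.1 (ratr wq.2) (walk (rep r z) wq.1).
  by rewrite ler_norml => /andP[_]; rewrite lerBlDl addrC.
Qed.

(** All classes having a walk within [r / 2] of a given [y] coincide, two such endpoints being less
    than [r] apart. Hence a single code position per point of [F] excludes the intruder. *)
Lemma code_prefix_isolates x (F : seq M) : separable_ball r x ->
  exists N, forall y z w, y \in F -> separable_ball r z ->
    (forall j, (j < N)%N -> code z j = code x j) ->
    mdist (walk (rep r z) w) y < r / 2 -> chained r x z.
Proof.
move=> Ax; elim: F => [|y F [N NP]]; first by exists 0%N.
have Arep z w : separable_ball r z -> separable_ball r (walk (rep r z) w).
  move=> Az; rewrite -(separable_ball_chained (walk_chained _ _)).
  by rewrite -(separable_ball_chained (rep_chained _ _)).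
have [[z1 [w1 [Az1 nxz1 yz1]]]|nz] := pselect (exists z1 w1, [/\ separable_ball r z1,
    ~ chained r x z1 & mdist (walk (rep r z1) w1) y < r / 2]); last first.
  exists N => y' z w; rewrite inE => /orP[/eqP->{y'}|]; last exact: NP.
  by move=> Az _ yz; apply: contrapT => nxz; apply: nz; exists z, w.
have [k kP] : exists k, code z1 k <> code x k.
  apply: contrapT => nk; apply: nxz1; rewrite -code_chained//.
  by apply/funext => k; apply: contrapT => kP; apply: nk; exists k => /esym.
exists (maxn N k.+1) => y' z w; rewrite inE => /orP[/eqP->{y'}|yF]; last first.
  by move=> Az zN; apply: NP yF Az _ => j jN; apply: zN; rewrite leq_max jN.
move=> Az zk yz; exfalso; apply: kP; rewrite -zk ?leq_max ?leqnn ?orbT//.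
suff /(code_chained Az1 Az) -> : chained r z1 z by [].
apply: (rst_trans _ _ _ (walk (rep r z) w)); last first.
  by apply: rst_sym; apply: rst_trans (rep_chained _ _) (walk_chained _ _).
apply: (rst_trans _ _ _ (walk (rep r z1) w1)).
  by apply: rst_trans (rep_chained _ _) (walk_chained _ _).
apply: rst_step; split; [exact: Arep|exact: Arep|].
rewrite (le_lt_trans (metric_triangle _ y _))// (metric_sym y).
by rewrite [ltRHS]splitr ltrD.
Qed.

Lemma cones_below x (L : nat) (g : M -> R) (F : seq M) (eta : R) :
  separable_ball r x -> lip_consts g L%:R ->
  (forall y, 0 <= g y <= L%:R * r / 2) ->
  (forall y, g y != 0 -> chained r x y) -> 0 < eta ->
  exists l : seq (seq (nat * nat) * rat),
    (forall wq, wq \in l -> ratr wq.2 <= g (walk (rep r x) wq.1)) /\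
    forall y, y \in F -> g y != 0 -> exists wq, wq \in l /\
      g y - eta <= cone L (ratr wq.2) (walk (rep r x) wq.1) y.
Proof.
move=> Ax [_ gL] gB gx eta0; elim: F => [|y F [l [lg lF]]]; first by exists [::].
have [gy0|gy0] := eqVneq (g y) 0.
  exists l; split=> // y'; rewrite inE => /orP[/eqP->|/lF//].
  by rewrite gy0 eqxx.
have xy : chained r (rep r x) y.
  by apply: rst_trans (gx _ gy0); exact: rst_sym (rep_chained r x).
have Arep : separable_ball r (rep r x).
  by rewrite -(separable_ball_chained (rep_chained _ _)).
have L1 : 0 < (L%:R + 1 : R) by rewrite ltr_wpDl.
(* The loss [eta] splits into [eta / 4] from [g y] to [g p], [eta / 2] from [g p] to [q], and
   [eta / 4] along the cone. The added 1 covers [L = 0]. *)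
have [|w wy] := walk_dense Arep xy (eps := eta / 4 / (L%:R + 1)).
  by rewrite !divr_gt0.
set p := walk (rep r x) w in wy.
have [|q] := @rat_in_itvoo R (g p - eta / 2) (g p).
  by rewrite gtrBl divr_gt0.
rewrite in_itv/= => /andP[qg gq].
exists ((w, q) :: l); split=> [wq|y'].
  by rewrite inE => /orP[/eqP->|/lg//]; exact: ltW.
rewrite inE => /orP[/eqP-> _|/lF H /H[wq [wql wqy]]]; last first.
  by exists wq; rewrite inE wql orbT.
exists (w, q); split; first exact: mem_head.
rewrite /cone /= -/p le_max; apply/orP; right.
have /min_idPl -> : ratr q <= L%:R * r / 2.
  by rewrite (le_trans (ltW gq))//; case/andP: (gB p).
have Ld : L%:R * mdist p y <= eta / 4.
  rewrite (le_trans (ler_wpM2l _ (ltW wy)))// mulrCA ler_piMr ?divr_ge0 ?(ltW eta0)//.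
  by rewrite ler_pdivrMr// mul1r lerDl.
have := gL p y; rewrite ler_norml => /andP[+ _] => gpy.
by lra.
Qed.

(** Cones of slope [L] with apex below the graph of [g] stay below it, and a long prefix makes the
    copies in other classes vanish on [F]. The slope does not depend on [eta], as [tight_approx]
    requires. *)
Lemma test_approx x (L : nat) (g : M -> R) (F : seq M) (eta : R) :
  separable_ball r x -> lip_consts g L%:R ->
  (forall y, 0 <= g y <= L%:R * r / 2) ->
  (forall y, g y != 0 -> chained r x y) -> 0 < eta ->
  exists i, i.1.1 = L /\ forall y, y \in F -> `|test i y - g y| <= eta.
Proof.
move=> Ax gL gB gx eta0.
have [l [lg lF]] := @cones_below x L g F eta Ax gL gB gx eta0.
have [N NP] := code_prefix_isolates F Ax.
exists (L, l, mkseq (code x) N); split=> // y yF.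
have upper v : test_values (L, l, mkseq (code x) N) y v -> v <= g y.
  have /andP[gy0 _] := gB y.
  move=> [->//|[z [wq [Az + wql ->]]]]; rewrite /= size_mkseq => zN.
  rewrite /cone ge_max gy0/= leNgt; apply/negP => gcone.
  (* A cone exceeding [g y] is positive at [y], so by the cap its apex lies within [r / 2] of
     [y]. *)
  have xz : chained r x z.
    apply: (NP y z wq.1 yF Az) => [j jN|]; first by rewrite zN// nth_mkseq.
    rewrite ltNge; apply/negP => dr.
    suff : Num.min (ratr wq.2) (L%:R * r / 2) - L%:R * mdist (walk (rep r z) wq.1) y <= 0.
      by move=> /(lt_le_trans gcone); rewrite ltNge gy0.
    rewrite subr_le0 ge_min -mulrA ler_wpM2l ?orbT//.
  move: gcone; rewrite -(eq_rep xz) ltNge => /negP; apply.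
  have [_ /(_ (walk (rep r x) wq.1) y)] := gL; rewrite ler_norml => /andP[_ gpy].
  rewrite (@le_trans _ _ (g (walk (rep r x) wq.1) - L%:R * mdist (walk (rep r x) wq.1) y))//.
    by rewrite lerD2r ge_min lg.
  by rewrite lerBlDr -lerBlDl.
have test_ge v : test_values (L, l, mkseq (code x) N) y v ->
    v <= test (L, l, mkseq (code x) N) y.
  by move=> yv; apply: ub_le_sup => //; exists (g y).
have test_le : test (L, l, mkseq (code x) N) y <= g y.
  by apply: ge_sup => //; exists 0; left.
rewrite distrC ger0_norm ?subr_ge0// lerBlDl -lerBlDr.
have [gy0|gy0] := eqVneq (g y) 0.
  by rewrite gy0 sub0r (@le_trans _ _ 0) ?oppr_le0 ?(ltW eta0)//; apply: test_ge; left.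
have [wq [wql /le_trans]] := lF y yF gy0; apply; apply: test_ge; right.
exists x, wq; split=> // j; rewrite /= size_mkseq => jN.
by rewrite nth_mkseq.
Qed.

End tests.

(** * Codes of classes, truncation and separation *)

Section separation.
Context {R : realType} {M : pMetricType R}.

Lemma countable_enum (T : Type) (A : set T) (x0 : T) : countable A ->
  exists e : nat -> T, forall a, A a -> exists j, e j = a.
Proof.
move=> /pcard_leTP[f].
have /choice[e eP] j : exists x, (exists2 a, A a & f a = j) -> A x /\ f x = j.
  have [[a Aa fa]|na] := pselect (exists2 a, A a & f a = j); first by exists a.
  by exists x0.
exists e => a Aa; exists (f a).
have [|Ae fe] := eP (f a); first by exists a.
by apply: (@inj _ _ _ f) => //; rewrite inE.
Qed.

Lemma locally_separable_ball (x : M) : locally_separable M ->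
  exists2 rho : R, 0 < rho & separable_ball rho x.
Proof.
move=> /(_ x)[U /nbhs_ballP[rho /= rho0 rhoU] [D Dcount Ddense]].
exists rho => //.
have [|e eP] := @countable_enum _ (set_val @` D) x.
  exact: sub_countable (card_image_le _ _) Dcount.
exists e => y xy eps eps0.
have Uy : U y by apply: rhoU; rewrite ballEmdist.
have [||a [/= ya Da]] := Ddense (set_val @^-1` (ball y eps)^°).
- exists (exist _ y (mem_set Uy)); exact: nbhsx_ballx.
- by exists (ball y eps)^°; [exact: open_interior|].
have [|j ej] := eP (set_val a); first by exists a.
exists j; rewrite ej metric_sym.
by move: ya => /interior_subset; rewrite ballEmdist.
Qed.

Lemma separable_ball_sub (r rho : R) (x y : M) : r + mdist x y <= rho ->
  separable_ball rho x -> separable_ball r y.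
Proof.
move=> rrho [e eP]; exists e => z yz; apply: eP.
rewrite (lt_le_trans _ rrho)// (le_lt_trans (metric_triangle _ y _))//.
by rewrite addrC ltrD2r.
Qed.

(** A class is coded by a point of the dense set within [r / 2] of its representative; two
    representatives sharing that point are less than [r] apart, hence one step apart. *)
Lemma chained_codes (r : R) : 0 < r -> dens_le M [set: nat -> bool] ->
  exists code : M -> nat -> bool, forall x y : M,
    separable_ball r x -> separable_ball r y ->
    code x = code y <-> chained r x y.
Proof.
move=> r0 [D Ddense /pcard_leTP[c]].
have /choice[d dP] x : exists y, D y /\ mdist x y < r / 2.
  have r2 : 0 < r / 2 by rewrite divr_gt0.
  have [||y [/= xy Dy]] := Ddense (ball x (r / 2))^°.
  - by exists x; exact: nbhsx_ballx.
  - exact: open_interior.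
  by exists y; split=> //; move: xy => /interior_subset; rewrite ballEmdist.
exists (fun x => c (d (rep r x))) => x y Ax Ay; split=> [cxy|/eq_rep->//].
have dxy : d (rep r x) = d (rep r y).
  by apply: (@inj _ _ _ c) => //; rewrite inE; case: (dP (rep r x)) (dP (rep r y)) => ? _ [].
apply: rst_trans (rep_chained r x) (rst_trans _ _ _ _ _ _ (rst_sym _ _ _ _ (rep_chained r y))).
apply: rst_step; split.
- by rewrite -(separable_ball_chained (rep_chained _ _)).
- by rewrite -(separable_ball_chained (rep_chained _ _)).
rewrite (le_lt_trans (metric_triangle _ (d (rep r x)) _))// [ltRHS]splitr ltrD//.
  by case: (dP (rep r x)).
by rewrite dxy metric_sym; case: (dP (rep r y)).
Qed.

Definition test_index : Type := nat * seq (seq (nat * nat) * rat) * seq bool.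

Lemma ex_tests (r : R) : 0 < r -> dens_le M [set: nat -> bool] ->
  exists T : test_index -> M -> R,
    (forall i, lip_consts (T i) i.1.1%:R) /\
    forall (x : M) (L : nat) (g : M -> R) (F : seq M) (eta : R),
      separable_ball r x -> lip_consts g L%:R ->
      (forall y, 0 <= g y <= L%:R * r / 2) ->
      (forall y, g y != 0 -> chained r x y) -> 0 < eta ->
      exists i, i.1.1 = L /\ forall y, y \in F -> `|T i y - g y| <= eta.
Proof.
move=> r0 /(chained_codes r0)[code codeP].
have [s [s_chained s_dense]] := @dense_steps R M r.
exists (@test R M r s code); split=> [i|x L g F eta].
  exact: lip_consts_test.
exact: test_approx.
Qed.

Lemma detected_truncation (mu : dual (lip0 M)) (f : lip0 M) :
  tight mu -> mu f != 0 -> exists b g, detected mu b g.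
Proof.
move=> mut muf.
have fL : lip_consts f `|f| by split=> [|x y]; [exact: normr_ge0|exact: lip0_normP].
have [|s [eta [eta0 sP]]] := @tight_approx _ _ mu f `|f| mut fL.
  by rewrite recenter_id.
(* This height dominates [f] on [s], so truncating [f] between [- b] and [b] does not change it
   there; the later shift by [b] gives nonnegativity and is erased by recentring. *)
pose b := \sum_(x <- s) `|f x|.
have b0 : 0 <= b by exact: sumr_ge0.
have fb x : x \in s -> `|f x| <= b.
  rewrite /b; elim: s {sP b b0} => // y s IH; rewrite inE big_cons => /orP[/eqP->|/IH xs].
    by rewrite lerDl sumr_ge0.
  by rewrite (le_trans xs)// lerDr.
pose h x := Num.max (- b) (- Num.max (- b) (- f x)).
have cstL c : lip_consts (fun _ : M => c) `|f|.
  exact: lip_consts_le (normr_ge0 _) (lip_consts_cst c).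
have hL : lip_consts h `|f|.
  apply: lip_consts_max => //; apply: lip_constsN; apply: lip_consts_max => //.
  exact: lip_constsN.
exists (b + b), (fun x => h x + b); split.
- move=> x; have hb : h x <= b.
    by rewrite /h ge_max ge0_cp// lerNl le_max lexx.
  have bh : - b <= h x by rewrite /h le_max lexx.
  by apply/andP; split; lra.
- by exists (`|f| + `|f|); apply: lip_constsD.
- rewrite (recenterD hL (cstL b)) recenter_cst addr0; apply: sP => // x /fb.
  rewrite ler_norml => /andP[bf fb'].
  have -> : h x = f x.
    rewrite /h; have /max_idPr -> : - b <= - f x by rewrite lerN2.
    by rewrite opprK; apply/max_idPr.
  by rewrite subrr normr0 ltW.
Qed.

Lemma tests_separate (T : nat -> test_index -> M -> R) (mu : dual (lip0 M)) :
  sequentially_complete M -> locally_separable M ->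
  (forall n i, lip_consts (T n i) i.1.1%:R) ->
  (forall n (x : M) (L : nat) (g : M -> R) (F : seq M) (eta : R),
      separable_ball n.+1%:R^-1 x -> lip_consts g L%:R ->
      (forall y, 0 <= g y <= L%:R * n.+1%:R^-1 / 2) ->
      (forall y, g y != 0 -> chained n.+1%:R^-1 x y) -> 0 < eta ->
      exists i, i.1.1 = L /\ forall y, y \in F -> `|T n i y - g y| <= eta) ->
  tight mu -> (forall n i, mu (recenter (T n i)) = 0) -> forall f, mu f = 0.
Proof.
move=> Mc Msep TL Tapprox mut muT f; apply/eqP; apply: contrapT => /negP muf.
have [b [g0 /(concentration Mc mut)[x xP]]] := detected_truncation mut muf.
have [rho rho0 Ax] := locally_separable_ball x Msep.
(* With [r] below [rho / 2], every point within [r] of [x] is the centre of a separable [r]-ball. *)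
have [|n nrho] := @natSinv_lt R (rho / 2); first by rewrite divr_gt0.
set r := n.+1%:R^-1 in nrho.
have r0 : 0 < r by rewrite invr_gt0.
have [g [[gb [K gK] mug] gx]] := xP r r0.
have b0 : 0 <= b by have /andP[/le_trans] := gb point; apply.
have K0 : 0 <= K by case: gK.
have br0 : 0 <= 2 * b / r by rewrite divr_ge0 ?mulr_ge0 ?(ltW r0).
(* The term [2 * b / r] brings the height [b] below the cap [L%:R * r / 2] of the cones. *)
have [L KL] : exists L : nat, K + 2 * b / r <= L%:R.
  by exists (Num.bound (K + 2 * b / r)); rewrite ltW// archi_boundP// addr_ge0.
have gL : lip_consts g L%:R.
  by apply: lip_consts_le gK; rewrite (le_trans _ KL)// lerDl.
have [F [eta [eta0 FP]]] := tight_approx mut gL mug.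
have Ar y : mdist x y < r -> separable_ball r y.
  move=> xy; apply: separable_ball_sub Ax; rewrite ltW//.
  by rewrite [ltRHS]splitr ltrD// (lt_trans xy).
have Arx : separable_ball r x by apply: Ar; rewrite mdistxx.
have [||i [iL iF]] := Tapprox n x L g F eta Arx gL _ _ eta0.
- move=> y; have /andP[-> gby] := gb y; rewrite (le_trans gby)//.
  have -> : b = (2 * b / r) * r / 2 by field; rewrite gt_eqF.
  by rewrite ler_pM2r// ler_wpM2r ?(ltW r0)// (le_trans _ KL)// lerDr.
- by move=> y /gx xy; apply: rst_step; split=> //; exact: Ar.
have := FP (T n i) _ iF; rewrite muT eqxx -iL => /(_ (TL _ _)).
by [].
Qed.

End separation.

Theorem theorem21 (R : realType) (M : completeMetricType R) :
  locally_separable M ->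
  dens_le M [set: nat -> bool] ->
  separable (lip0_wstar M).
Proof.
move=> Msep Mdens.
have r0 n : 0 < n.+1%:R^-1 :> R by rewrite invr_gt0.
have [T TP] := choice (fun n => ex_tests (r0 n) Mdens).
apply: (@separating_separable R M (nat * test_index)%type
  (fun ni => recenter (T ni.1 ni.2))) => mu mut muT.
apply: (@tests_separate R M T mu) => //.
- exact: completeMetric_sequentially_complete.
- by move=> n; case: (TP n).
- by move=> n; case: (TP n).
- by move=> n i; exact: (muT (n, i)).
Qed.
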